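(* Let $X$ be a topological space with $|X| \le \mathfrak{c}$ such that $(\mathfrak{c},\omega)$ is a pinning down pair for $X$. Then $X$ is separable.
   Context: No separation axioms are assumed. $\mathfrak{c} = 2^{\omega}$. For cardinals $\kappa > \lambda \ge \omega$, $(\kappa,\lambda)$ is a pinning down pair for a topological space $X$ if for every family $\mathcal{U}$ of non-empty open sets in $X$ with $|\mathcal{U}| \le \kappa$ there is $B \subset X$ with $|B| \le \lambda$ such that $B \cap U \ne \emptyset$ for each $U \in \mathcal{U}$. *)

(* Defs.v *)
From HB Require Import structures.
From mathcomp Require Import all_boot.
From mathcomp Require Import boolp classical_sets functions cardinality.
From mathcomp Require Import topology.
Set Implicit Arguments.
Unset Strict Implicit.
Unset Printing Implicit Defensive.
Local Open Scope classical_set_scope.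
Local Open Scope card_scope.

(* A cardinal is given by any set having that cardinality. *)

Definition card_lt S T (A : set S) (B : set T) : Prop :=
  A #<= B /\ ~ (B #<= A).

Definition omega : set nat := setT.

Definition continuum : set (nat -> bool) := setT.

Definition pinning_down_pair (X : topologicalType) S T
    (kappa : set S) (lambda : set T) : Prop :=
  [/\ card_lt lambda kappa,
      omega #<= lambda &
      forall U : set (set X),
        (forall O, U O -> open O /\ O !=set0) ->
        U #<= kappa ->
        exists B : set X, B #<= lambda /\ forall O, U O -> B `&` O !=set0].

Definition separable_space (X : topologicalType) : Prop :=
  exists D : set X, countable D /\ dense D.

(* The cardinal conditions in [pinning_down_pair] hold automatically for
   [continuum] and [omega]. *)
Lemma omega_lt_continuum : card_lt omega continuum.
Proof.
split.
  apply/pcard_injP; exists (fun n m => n == m) => n m _ _ nm.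
  by apply/eqP; rewrite (congr1 (fun h => h m) nm) /= eqxx.
move=> /pcard_injP[f finj].
pose d n := `[< exists2 g, f g = n & ~~ g n >].
have [dfd|ndfd] := boolP (d (f d)).
  have /asboolP[g fgd] := dfd.
  by rewrite (finj g d _ _ fgd) ?inE// dfd.
by have /asboolP[] := ndfd; exists d.
Qed.

(* Main.v *)
(* A countable subset of X is determined by a sequence of points of 2^omega, so
   at most c many countable sets suffice to cover all of them.  If none of them
   is dense, the complements of their closures form a family of at most c
   non-empty open sets, and no countable set meets all of these. *)
Require Import Defs.
From mathcomp Require Import all_boot.
From mathcomp Require Import boolp classical_sets functions cardinality.
From mathcomp Require Import topology.
Local Open Scope classical_set_scope.
Local Open Scope card_scope.

(** [g] codes a sequence of points of 2^omega: the n-th is row n of the array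
    [g (pickle (n, m))]. *)
Definition decode {T} (i : T -> nat -> bool) (g : nat -> bool) : set T :=
  [set x | exists n : nat, forall m : nat, i x m = g (pickle (n, m))].

(** Each row of [g] is the code of at most one point. *)
Lemma countable_decode {T} (i : T -> nat -> bool) (g : nat -> bool) :
  injective i -> countable (decode i g).
Proof.
move=> inji.
have /choice[f fP] : forall x, exists n : nat,
    decode i g x -> forall m, i x m = g (pickle (n, m)).
  move=> x; have [[n xn]|ndx] := pselect (decode i g x); first by exists n.
  by exists 0%N => /ndx.
apply/pcard_injP; exists f => x y /set_mem xg /set_mem yg fxy.
by apply/inji/funext => m; rewrite (fP x)// (fP y)// fxy.
Qed.

Lemma countable_sub_decode {T} (i : T -> nat -> bool) (B : set T) :
  countable B -> exists g, B `<=` decode i g.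
Proof.
move=> /pcard_injP[h hinj].
(* For [x] in [B], row [h x] is [i x]. All other rows are constantly [false], which may add a point
   outside [B]; hence only an inclusion. *)
exists (fun k => `[< exists x (m : nat), [/\ B x, k = pickle (h x, m) & i x m] >]).
move=> x Bx; exists (h x) => m; apply/idP/asboolP => [ixm|]; first by exists x, m.
move=> [y [p [By /(pcan_inj pickleK)[hxy ->] iyp]]].
by rewrite (hinj x y) ?inE.
Qed.

Theorem corollary2p2 (X : topologicalType)
    (cardX : [set: X] #<= continuum)
    (pinX : pinning_down_pair X continuum omega) :
  separable_space X.
Proof.
have /pcard_injP[i iinj] := cardX.
have inji : injective i by move=> x y; apply: iinj; rewrite inE.
apply: contrapT => nsepX.
have [_ _ /(_ ((fun g => ~` closure (decode i g)) @` setT))] := pinX.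
case=> [_ [g _ <-]||B [/(countable_sub_decode i)[g Bg] BU]].
- split; first exact/closed_openC/closed_closure.
  (* Were the complement empty, the countable [decode i g] would be dense. *)
  apply: contrapT => /nonemptyPn clg0; apply: nsepX.
  exists (decode i g); split; first exact: countable_decode.
  move=> O [x Ox] oO; rewrite setIC.
  have /contrapT : ~ (~` closure (decode i g)) x by rewrite clg0.
  by apply; apply: open_nbhs_nbhs.
- exact: card_image_le.
- have [x [Bx]] : B `&` ~` closure (decode i g) !=set0 by apply: BU; exists g.
  by apply; apply/subset_closure/Bg.
Qed.
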